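(* The Hilbert transform $H$ on $\mathbb{R}$ is two weight norm unstable under biLipschitz pushforwards of arbitrary pairs of locally finite positive Borel measures: there is no function $\mathcal{G}:[0,\infty)^2\to[0,\infty)$ mapping bounded sets to bounded sets such that $$\mathfrak{N}_H(\Phi_*\sigma,\Phi_*\omega)\le\mathcal{G}\big(\|\Phi\|_{\mathrm{biLip}},\mathfrak{N}_H(\sigma,\omega)\big)$$ for all locally finite positive Borel measures $\sigma,\omega$ on $\mathbb{R}$ with $\mathfrak{N}_H(\sigma,\omega)<\infty$ and all biLipschitz $\Phi:\mathbb{R}\to\mathbb{R}$.
   Context: $\Phi_*\mu(B)=\mu(\Phi^{-1}(B))$. For a continuous invertible $\Phi:\mathbb{R}\to\mathbb{R}$ put $\|\Phi\|_{\mathrm{biLip}}=\sup_{x\neq y}\frac{|\Phi(x)-\Phi(y)|}{|x-y|}+\sup_{x\neq y}\frac{|\Phi^{-1}(x)-\Phi^{-1}(y)|}{|x-y|}$; $\Phi$ is biLipschitz if this is finite. $H$ has kernel $K(x,y)=\frac1{\pi(x-y)}$. Fix a family $\{\eta_{\delta,R}\}_{0<\delta<R<\infty}$ of nonnegative functions on $[0,\infty)$, with $\eta_{\delta,R}\to1$ pointwise on $(0,\infty)$ as $\delta\to0$, $R\to\infty$, such that $K_{\delta,R}(x,y)=\eta_{\delta,R}(|x-y|)K(x,y)$ are bounded, have compact support for fixed $x$ or $y$, and satisfy $|K_{\delta,R}(x,y)|\le C|x-y|^{-1}$, $|\partial_xK_{\delta,R}|+|\partial_yK_{\delta,R}|\le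 C|x-y|^{-2}$ uniformly in $\delta,R$. Then $\mathfrak{N}_H(\sigma,\omega)\in[0,\infty]$ is the best constant $\mathfrak{N}$ with $\left\|\int K_{\delta,R}(\cdot,y)f(y)\,d\sigma(y)\right\|_{L^2(\omega)}\le\mathfrak{N}\|f\|_{L^2(\sigma)}$ for all $f\in L^2(\sigma)$ and $0<\delta<R<\infty$. *)

(* Defs.v *)
From HB Require Import structures.
From mathcomp Require Import all_boot all_order all_algebra.
From mathcomp Require Import all_classical all_reals all_analysis.
From mathcomp Require Import measurable_realfun.

Set Implicit Arguments.
Unset Strict Implicit.
Unset Printing Implicit Defensive.
Import Order.TTheory GRing.Theory Num.Theory.
Import numFieldNormedType.Exports.

Local Open Scope classical_set_scope.
Local Open Scope ring_scope.

(* A realType carries its Borel sigma-algebra, so [{measure set R -> \bar R}] is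
   the type of positive Borel measures on the line. *)
Definition locally_finite (R : realType) (mu : {measure set R -> \bar R}) :
    Prop :=
  forall x : R, exists2 U : set R, open_nbhs x U & (mu U < +oo)%E.

(* [pushforward mu Phi] is a measure only for measurable Phi; continuity is
   passed as an argument to ensure this. *)
Definition push_measure (R : realType) (mu : {measure set R -> \bar R})
    (Phi : R -> R) (cPhi : continuous Phi) : {measure set R -> \bar R} :=
  measure_function_pushforward__canonical__measure_function_Measure mu
    (continuous_measurable_fun cPhi).

Lemma push_measureE (R : realType) (mu : {measure set R -> \bar R})
    (Phi : R -> R) (cPhi : continuous Phi) (B : set R) :
  push_measure mu cPhi B = mu (Phi @^-1` B).
Proof. by []. Qed.

Section BiLipschitz.
Context (R : realType).

Definition lip_seminorm (f : R -> R) : \bar R :=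
  ereal_sup [set (`|f p.1 - f p.2| / `|p.1 - p.2|)%:E |
    p in [set p : R * R | p.1 != p.2]].

(* Psi stands for the inverse of Phi. *)
Definition bilip_norm (Phi Psi : R -> R) : \bar R :=
  (lip_seminorm Phi + lip_seminorm Psi)%E.

End BiLipschitz.

Section TwoWeightNorm.
Context (R : realType).

(* As 0^-1 = 0, this kernel and its truncations vanish on the diagonal. *)
Definition hilbert_kernel (x y : R) : R := 1 / (pi * (x - y)).

(* [eta d r] is the truncation function with parameters 0 < d < r; its values
   for other d and r, or at negative reals, are never used. *)
Definition trunc_kernel (eta : R -> R -> R -> R) (d r x y : R) : R :=
  eta d r `|x - y| * hilbert_kernel x y.

Record admissible_truncation (eta : R -> R -> R -> R) : Prop := {
  trunc_ge0 : forall d r t : R, 0 < d -> d < r -> 0 <= t -> 0 <= eta d r t;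
  trunc_cvg1 : forall t : R, 0 < t ->
    eta p.1 p.2 t @[p --> filter_prod 0^'+ +oo] --> (1 : R);
  trunc_bounded : forall d r : R, 0 < d -> d < r ->
    exists M : R, forall x y : R, `|trunc_kernel eta d r x y| <= M;
  trunc_compactl : forall d r x : R, 0 < d -> d < r ->
    compact (closure [set y : R | trunc_kernel eta d r x y != 0]);
  trunc_compactr : forall d r y : R, 0 < d -> d < r ->
    compact (closure [set x : R | trunc_kernel eta d r x y != 0]);
  trunc_CZ : exists C : R, forall d r x y : R, 0 < d -> d < r -> x != y ->
    [/\ `|trunc_kernel eta d r x y| <= C * `|x - y|^-1,
        derivable (fun u : R => trunc_kernel eta d r u y) x 1,
        derivable (fun v : R => trunc_kernel eta d r x v) y 1 &
        `|derive1 (fun u : R => trunc_kernel eta d r u y) x| +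
        `|derive1 (fun v : R => trunc_kernel eta d r x v) y|
          <= C * `|x - y| ^- 2]
}.

Definition trunc_hilbert (eta : R -> R -> R -> R) (d r : R)
    (sigma : {measure set R -> \bar R}) (f : R -> R) : R -> R :=
  fun x => \int[sigma]_y (trunc_kernel eta d r x y * f y).

(* The infimum of the empty set is +oo. *)
Definition hilbert_norm (eta : R -> R -> R -> R)
    (sigma omega : {measure set R -> \bar R}) : \bar R :=
  ereal_inf [set N%:E | N in [set N : R | 0 <= N /\
    forall (f : R -> R) (d r : R),
      f \in Lfun sigma 2%:E -> 0 < d -> d < r ->
      ('N[omega]_2%:E[EFin \o trunc_hilbert eta d r sigma f]
         <= N%:E * 'N[sigma]_2%:E[EFin \o f])%E]].

End TwoWeightNorm.

(* Main.v *)
Require Import Defs.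
From mathcomp Require Import all_boot all_order all_algebra.
From mathcomp Require Import all_classical all_reals all_analysis.
From mathcomp Require Import measurable_realfun ring lra.

(** Instability comes from a symmetry that biLipschitz maps destroy.  Fix a
    number N of generations and a very small ratio rho.  For signs
    e_0, ..., e_(N-1) put c_k(e) = sum_(j<k) e_j rho^j.  The points c_N(e) are
    the leaves of a binary tree of intervals: below the node c_k(e), of scale
    rho^k, the leaves form two clusters of relative size rho, placed at distance
    about rho^k to its left and to its right.  Let sigma be the uniform
    probability on the leaves, and let omega put on the node c_k(e), up to a
    constant, the largest mass that the two weight A_2 condition permits, namely
    rho^(2k) / sigma(I) = rho^(2k) 2^k.

    A truncated kernel is odd.  Seen from the node c_k(e) it is, up to a
    relative error O(rho), constant on the right cluster and equal to the
    opposite constant on the left one, while the leaves that are not below the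
    node contribute O(rho) in the same units.  With the weights of omega, the
    truncated operator is thus a bounded diagonal multiple of the Haar system of
    the tree, plus an error that is negligible once rho is small compared with
    2^-N / N.  The Bessel inequality bounds its norm by twice the constant C of the
    kernel estimates, whatever N and the truncation are: haar_bessel,
    kernel_haar, haar_upper.  The symmetry used is oddness, which every truncation
    preserves; this is why the bound is uniform in the truncation.

    The map Phi(x) = x + dist(x, leaves) / 4 fixes every leaf and shifts the node
    c_k(e) by an amount between rho^k / 8 and 3 rho^k / 8; its biLipschitz norm is
    at most 3 (bilip_perturbation).  The right cluster is now closer than the left
    one, so that the Hilbert transform of sigma at the shifted node is at most
    - c sigma(I) / rho^k (shifted_lower).  Each generation therefore contributes a
    fixed amount to the squared L^2(omega) norm of H(sigma), while the constant
    function 1 has norm 1 in L^2(sigma): the squared norm of the pushed forward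
    pair is at least a constant times N (unstable_pair).  The passage from
    truncations to the kernel 1/(pi(x-y)) itself is a limit of finite sums. *)

Set Implicit Arguments.
Unset Strict Implicit.
Unset Printing Implicit Defensive.

Import Order.TTheory GRing.Theory Num.Theory.
Import numFieldNormedType.Exports.

Local Open Scope classical_set_scope.
Local Open Scope ring_scope.

(** * The Haar system of a binary tree *)

Section Haar.
Context (R : realType) (n : nat).

(** The 2^N branches of a binary tree with N = n.+1 generations; [sgn j e] is
    the j-th sign, meaningful for j <= n. *)
Definition branch := {ffun 'I_n.+1 -> bool}.

Implicit Types (e : branch) (F f : branch -> R).

Definition sgn (j : nat) e : R := (-1) ^+ e (inord j).

Definition avg F : R := 2^-1 ^+ n.+1 * \sum_e F e.

Definition flip (j : nat) e : branch := [ffun i => e i (+) (i == inord j)].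

Lemma flipK j : involutive (flip j).
Proof. by move=> e; apply/ffunP => i; rewrite !ffunE -addbA addbb addbF. Qed.

Lemma sgn_sqr j e : sgn j e ^+ 2 = 1.
Proof. exact: sqrr_sign. Qed.

Lemma sgnP j e : sgn j e = 1 \/ sgn j e = -1.
Proof. by rewrite /sgn; case: (e _); [right|left]; rewrite ?expr1 ?expr0. Qed.

Lemma normr_sgn j e : `|sgn j e| = 1.
Proof. exact: normr_sign. Qed.

Lemma sgn_flip j e : sgn j (flip j e) = - sgn j e.
Proof. by rewrite /sgn ffunE eqxx addbT; case: (e _); rewrite ?expr1 ?expr0 ?opprK. Qed.

Lemma sgn_flip_lt i j e : (i < j <= n)%N -> sgn i (flip j e) = sgn i e.
Proof.
move=> /andP[ij jn]; rewrite /sgn ffunE -val_eqE /= !inordK ?ltnS //.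
  by rewrite ltn_eqF// addbF.
by rewrite (leq_trans (ltnW ij)).
Qed.

Lemma avgD F f : avg (fun e => F e + f e) = avg F + avg f.
Proof. by rewrite /avg big_split mulrDr. Qed.

Lemma avgZ (a : R) F : avg (fun e => a * F e) = a * avg F.
Proof. by rewrite /avg -mulr_sumr mulrCA. Qed.

Lemma avg_cst (a : R) : avg (fun=> a) = a.
Proof.
rewrite /avg big_const iter_addr_0 card_ffun card_bool card_ord.
rewrite -[a *+ _]mulr_natr natrX mulrCA -exprMn mulVf ?expr1n ?mulr1//.
Qed.

Lemma eq_avg F f : F =1 f -> avg F = avg f.
Proof. by move=> Ff; congr (_ * _); apply: eq_bigr => e _; rewrite Ff. Qed.

Lemma avg_le F f : (forall e, F e <= f e) -> avg F <= avg f.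
Proof.
move=> Ff; rewrite ler_wpM2l ?exprn_ge0 ?invr_ge0//; exact: ler_sum.
Qed.

Lemma avg_ge0 F : (forall e, 0 <= F e) -> 0 <= avg F.
Proof. by move=> F0; rewrite -(avg_cst 0) avg_le. Qed.

(** The variance of F is nonnegative. *)
Lemma sqr_avg_le F : avg F ^+ 2 <= avg (fun e => F e ^+ 2).
Proof.
rewrite -subr_ge0.
have -> : avg (fun e => F e ^+ 2) - avg F ^+ 2 = avg (fun e => (F e - avg F) ^+ 2).
  transitivity (avg (fun e => F e ^+ 2 + (- (2 * avg F) * F e + avg F ^+ 2))).
    rewrite avgD avgD avgZ avg_cst; ring.
  by apply: eq_avg => e; ring.
by apply: avg_ge0 => e; apply: sqr_ge0.
Qed.

Lemma avg_flip_odd j F : (forall e, F (flip j e) = - F e) -> avg F = 0.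
Proof.
move=> oddF; suff : avg F = - avg F by move=> h; lra.
rewrite -mulN1r -avgZ /avg; congr (_ * _).
rewrite (reindex_inj (inv_inj (flipK j))) /=.
by apply: eq_bigr => e _; rewrite oddF mulN1r.
Qed.

(** Equals 2^k or 0 according to whether e and e' agree in the first k signs
    (cylinderP); as a function of e', it is the density of the cylinder of e. *)
Definition cylinder (k : nat) e e' : R := \prod_(j < k) (1 + sgn j e * sgn j e').

Definition cond_avg k f e : R := avg (fun e' => cylinder k e e' * f e').

(** Up to normalization, the coefficient of f on the Haar function of the
    cylinder of e of length k. *)
Definition haar_coef k f e : R :=
  avg (fun e' => cylinder k e e' * (sgn k e' * f e')).

Lemma cylinderS k e e' :
  cylinder k.+1 e e' = cylinder k e e' * (1 + sgn k e * sgn k e').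
Proof. by rewrite /cylinder big_ord_recr. Qed.

Lemma cylinderC k e e' : cylinder k e e' = cylinder k e' e.
Proof. by apply: eq_bigr => j _; rewrite [_ * sgn j e]mulrC. Qed.

Lemma cylinder_flip k e e' : (k <= n)%N -> cylinder k e (flip k e') = cylinder k e e'.
Proof. by move=> kn; apply: eq_bigr => j _; rewrite sgn_flip_lt// ltn_ord. Qed.

(** In the second case j is the first generation at which the two branches part. *)
Lemma cylinderP k e e' :
  ((forall j, (j < k)%N -> sgn j e = sgn j e') /\ cylinder k e e' = 2 ^+ k) \/
  (exists2 j, (j < k)%N & [/\ forall i, (i < j)%N -> sgn i e = sgn i e',
     sgn j e' = - sgn j e & cylinder k e e' = 0]).
Proof.
elim: k => [|k [[agr pk]|[j jk [agr dis pk]]]].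
- by left; rewrite /cylinder big_ord0.
- have [kk|kk] : sgn k e' = sgn k e \/ sgn k e' = - sgn k e.
    by case: (sgnP k e) => ->; case: (sgnP k e') => ->; rewrite ?opprK; auto.
  + left; split; last first.
      by rewrite cylinderS pk kk -expr2 sgn_sqr exprSr.
    by move=> j; rewrite ltnS leq_eqVlt => /predU1P[->|/agr].
  + right; exists k => //; split => //.
    by rewrite cylinderS kk mulrN -expr2 sgn_sqr subrr mulr0.
- right; exists j; first exact: leq_trans jk _.
  by split => //; rewrite cylinderS pk mul0r.
Qed.

(** The factor sgn k is odd under the flip of the k-th sign, which preserves the
    cylinders of length k. *)
Lemma avg_cylinder_sgn k e : (k <= n)%N ->
  avg (fun e' => cylinder k e e' * sgn k e') = 0.
Proof.
move=> kn; apply: (@avg_flip_odd k) => e'.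
by rewrite cylinder_flip// sgn_flip mulrN.
Qed.

Lemma avg_cylinder k e : (k <= n.+1)%N -> avg (cylinder k e) = 1.
Proof.
elim: k => [_|k IH kn].
  by rewrite -[RHS]avg_cst; apply: eq_avg => e'; rewrite /cylinder big_ord0.
transitivity (avg (fun e' => cylinder k e e' + sgn k e * (cylinder k e e' * sgn k e'))).
  by apply: eq_avg => e'; rewrite cylinderS; ring.
by rewrite avgD avgZ IH ?avg_cylinder_sgn// 1?ltnW// mulr0 addr0.
Qed.

Lemma cond_avgS k f e :
  cond_avg k.+1 f e = cond_avg k f e + sgn k e * haar_coef k f e.
Proof.
by rewrite /cond_avg /haar_coef -avgZ -avgD; apply: eq_avg => e'; rewrite cylinderS; ring.
Qed.

Lemma cond_avg_full f e : cond_avg n.+1 f e = f e.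
Proof.
rewrite /cond_avg /avg (bigD1 e)//= big1 ?addr0.
  have [[_ ->]|[j _ [_ s _]]] := cylinderP n.+1 e e.
    by rewrite mulrA -exprMn mulVf// expr1n mul1r.
  by have [h|h] := sgnP j e; exfalso; move: s; rewrite h => ?; lra.
move=> e' ne; have [[agr _]|[j _ [_ _ ->]]] := cylinderP n.+1 e e'; last by rewrite mul0r.
case/eqP: ne; apply/ffunP => i.
have := agr i (ltn_ord i); rewrite /sgn inord_val.
by case: (e i); case: (e' i) => //; rewrite expr1 expr0 => ?; exfalso; lra.
Qed.

(** The martingale difference sgn k * haar_coef k f is orthogonal to cond_avg k f,
    because the product of the two is odd under the flip of the k-th sign. *)
Lemma avg_sqr_cond_avgS k f : (k <= n)%N ->
  avg (fun e => cond_avg k.+1 f e ^+ 2) =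
  avg (fun e => cond_avg k f e ^+ 2) + avg (fun e => haar_coef k f e ^+ 2).
Proof.
move=> kn.
have cf e e' : cylinder k (flip k e) e' = cylinder k e e'.
  by rewrite !(cylinderC _ _ e') cylinder_flip.
have oddF : avg (fun e => sgn k e * cond_avg k f e * haar_coef k f e) = 0.
  apply: (@avg_flip_odd k) => e; rewrite sgn_flip !mulNr; congr (- (_ * _ * _)).
    by apply: eq_avg => e'; rewrite cf.
  by apply: eq_avg => e'; rewrite cf.
transitivity (avg (fun e => cond_avg k f e ^+ 2 + (haar_coef k f e ^+ 2 +
   2 * (sgn k e * cond_avg k f e * haar_coef k f e)))).
  apply: eq_avg => e; rewrite cond_avgS.
  rewrite [in RHS](_ : haar_coef k f e ^+ 2 = sgn k e ^+ 2 * haar_coef k f e ^+ 2); last first.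
    by rewrite sgn_sqr mul1r.
  ring.
by rewrite avgD avgD avgZ oddF mulr0 addr0.
Qed.

(** The squared norms of cond_avg k f telescope, and cond_avg n.+1 f is f. *)
Lemma haar_bessel f :
  \sum_(k < n.+1) avg (fun e => haar_coef k f e ^+ 2) <= avg (fun e => f e ^+ 2).
Proof.
suff H k : (k <= n.+1)%N ->
    \sum_(i < k) avg (fun e => haar_coef i f e ^+ 2) <=
    avg (fun e => cond_avg k f e ^+ 2).
  apply: le_trans (H n.+1 (leqnn _)) _; apply: avg_le => e.
  by rewrite cond_avg_full.
elim: k => [_|k IH kn]; first by rewrite big_ord0 avg_ge0// => e; rewrite sqr_ge0.
by rewrite big_ord_recr avg_sqr_cond_avgS//= lerD2r IH// ltnW.
Qed.

End Haar.

(** * A lacunary tree of points on the line *)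

Section CantorPoints.
Context (R : realType) (n : nat) (rho : R).
Hypothesis (rho_gt0 : 0 < rho) (rho_small : rho <= 4^-1).

Implicit Types e : branch n.

(** The node of generation k on the branch e; it depends on the first k signs
    only. *)
Definition centre (k : nat) e : R := \sum_(j < k) sgn R j e * rho ^+ j.

Definition leaf e : R := centre n.+1 e.

Lemma centreS k e : centre k.+1 e = centre k e + sgn R k e * rho ^+ k.
Proof. by rewrite /centre big_ord_recr. Qed.

(** A geometric series: its tail is at most twice its first term. *)
Lemma dist_centre k m e : (k <= m)%N ->
  `|centre m e - centre k e| <= 2 * (rho ^+ k - rho ^+ m).
Proof.
elim: m => [|m IH]; first by rewrite leqn0 => /eqP ->; rewrite !subrr mulr0 normr0.
rewrite leq_eqVlt => /predU1P[->|]; first by rewrite !subrr mulr0 normr0.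
rewrite ltnS => /IH {}IH; rewrite centreS.
have h : `|sgn R m e * rho ^+ m| = rho ^+ m.
  by rewrite normrM normr_sgn mul1r ger0_norm// exprn_ge0// ltW.
have t : `|centre m e + sgn R m e * rho ^+ m - centre k e|
    <= `|centre m e - centre k e| + rho ^+ m.
  by rewrite addrAC -{2}h ler_normD.
have : rho ^+ m * rho <= rho ^+ m * 4^-1 by rewrite ler_pM2l// exprn_gt0.
have : 0 < rho ^+ m by rewrite exprn_gt0.
by move: t IH; rewrite (exprSr rho m); lra.
Qed.

Lemma eq_centre k e e' : (forall j, (j < k)%N -> sgn R j e = sgn R j e') ->
  centre k e = centre k e'.
Proof. by move=> agr; apply: eq_bigr => j _; rewrite agr. Qed.

(** The cluster of leaves below a node sits, up to a relative error of 2 rho, at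
    distance rho^k on the side given by the k-th sign. *)
Lemma leaf_agree k e e' : (k <= n)%N ->
  (forall j, (j < k)%N -> sgn R j e = sgn R j e') ->
  `|leaf e' - centre k e - sgn R k e' * rho ^+ k| <= 2 * rho ^+ k * rho.
Proof.
move=> kn /eq_centre ->; rewrite -addrA -opprD -centreS.
apply: le_trans (@dist_centre k.+1 n.+1 e' kn) _.
rewrite -mulrA -exprSr ler_pM2l// lerBlDr lerDl exprn_ge0// ltW//.
Qed.

(** Branches that part at generation j < k are separated at the scale rho^j,
    which is at least rho^k / rho. *)
Lemma leaf_disagree k j e e' : (k <= n)%N -> (j < k)%N ->
  (forall i, (i < j)%N -> sgn R i e = sgn R i e') -> sgn R j e' = - sgn R j e ->
  rho ^+ k <= rho * `|centre k e - leaf e'|.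
Proof.
move=> kn jk agr dis.
have r0 : 0 < rho ^+ j by rewrite exprn_gt0.
have h1 := dist_centre e jk.
have h2 := @dist_centre j.+1 n.+1 e' (leq_trans jk (leqW kn)).
have h3 : centre j.+1 e - centre j.+1 e' = 2 * (sgn R j e * rho ^+ j).
  by rewrite !centreS (eq_centre agr) dis; ring.
have h4 : `|centre j.+1 e - centre j.+1 e'| = 2 * rho ^+ j.
  rewrite h3 !normrM normr_sgn mul1r normr_nat ger0_norm// ltW//.
have h5 : 2 * rho ^+ j <= `|centre k e - centre j.+1 e| + `|leaf e' - centre j.+1 e'|
     + `|centre k e - leaf e'|.
  rewrite -h4.
  have -> : centre j.+1 e - centre j.+1 e' = - (centre k e - centre j.+1 e)
    + (leaf e' - centre j.+1 e') + (centre k e - leaf e') by ring.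
  apply: le_trans (ler_normD _ _) _; rewrite lerD2r.
  by apply: le_trans (ler_normD _ _) _; rewrite normrN.
have kj : rho ^+ k <= rho ^+ j.+1.
  by rewrite ler_wiXn2l ?ltW//; move: rho_small; lra.
have k0 : 0 <= rho ^+ k by rewrite exprn_ge0// ltW.
have k1 : 0 <= rho ^+ n.+1 by rewrite exprn_ge0// ltW.
rewrite -/(leaf e') in h2.
move: kj h1 h2; rewrite (exprSr rho j) => kj h1 h2.
have rj : rho ^+ j * rho <= rho ^+ j * 4^-1 by rewrite ler_pM2l.
have : rho ^+ j <= `|centre k e - leaf e'| by move: h5 h1 h2 rj k0 k1 kj; lra.
by move=> h; rewrite (le_trans kj)// mulrC ler_pM2l.
Qed.

Lemma leaf_dist_ge k e e' : (k <= n)%N ->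
  rho ^+ k / 2 <= `|centre k e - leaf e'|.
Proof.
move=> kn; have r0 : 0 < rho ^+ k by rewrite exprn_gt0.
have [[agr _]|[j jk [agr dis _]]] := cylinderP R k e e'.
  have := leaf_agree kn agr.
  have h : `|sgn R k e' * rho ^+ k| = rho ^+ k.
    by rewrite normrM normr_sgn mul1r gtr0_norm.
  have : `|sgn R k e' * rho ^+ k| <=
     `|leaf e' - centre k e - sgn R k e' * rho ^+ k| + `|centre k e - leaf e'|.
    rewrite -[leX in leX <= _]normrN; apply: le_trans (ler_normD _ _).
    by rewrite le_eqVlt; apply/orP; left; apply/eqP; congr (`|_|); ring.
  by rewrite h; move: (rho_small) (ler_wpM2l (ltW r0) rho_small); lra.
have := leaf_disagree kn jk agr dis; have := normr_ge0 (centre k e - leaf e').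
move: (normr_ge0 (centre k e - leaf e')) => d0; move: (ler_wpM2r d0 rho_small); lra.
Qed.

Lemma leaf_dist_le k e : (k <= n)%N ->
  `|centre k e - leaf e| <= 3 / 2 * rho ^+ k.
Proof.
move=> kn; have r0 : 0 < rho ^+ k by rewrite exprn_gt0.
have := leaf_agree kn (fun j _ => erefl (sgn R j e)).
have h : `|sgn R k e * rho ^+ k| = rho ^+ k.
  by rewrite normrM normr_sgn mul1r gtr0_norm.
have : `|centre k e - leaf e| <=
   `|leaf e - centre k e - sgn R k e * rho ^+ k| + `|sgn R k e * rho ^+ k|.
  by rewrite distrC -{1}[leaf e - centre k e](subrK (sgn R k e * rho ^+ k)) ler_normD.
rewrite h; move: (ler_wpM2l (ltW r0) rho_small); lra.
Qed.

Section Upper.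
Context (K : R -> R) (C : R).
Hypothesis C0 : 0 <= C.
Hypothesis K_odd : forall z, K (- z) = - K z.
Hypothesis K_size : forall z, z != 0 -> `|K z| <= C * `|z|^-1.
Hypothesis K_smooth : forall u v, 0 < `|u| -> `|v - u| <= `|u| / 2 ->
  `|K v - K u| <= 4 * C * `|v - u| * `|u| ^- 2.

(** The kernel between a node and a leaf is, up to a relative error O(rho), that
    of a multiple of the Haar function of the node: below the node this is oddness
    and smoothness of K, elsewhere it is the decay of K. *)
Lemma kernel_haar k e e' : (k <= n)%N ->
  `|K (centre k e - leaf e') +
     K (rho ^+ k) * (2^-1 ^+ k * cylinder R k e e' * sgn R k e')|
  <= 8 * C * rho / rho ^+ k.
Proof.
move=> kn; have r0 : 0 < rho ^+ k by rewrite exprn_gt0.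
have [[agr ->]|[j jk [agr dis ->]]] := cylinderP R k e e'.
  have la := leaf_agree kn agr.
  rewrite -exprMn mulVf// expr1n mul1r.
  set u := - (sgn R k e' * rho ^+ k).
  have Ku : K u = - (K (rho ^+ k) * sgn R k e').
    by rewrite /u; case: (sgnP R k e') => ->; rewrite ?mulrN1 ?mulN1r ?mul1r ?mulr1 !K_odd ?opprK.
  have nu : `|u| = rho ^+ k by rewrite normrN normrM normr_sgn mul1r gtr0_norm.
  have -> : K (rho ^+ k) * sgn R k e' = - K u by rewrite Ku opprK.
  have vu : `|centre k e - leaf e' - u| <= 2 * rho ^+ k * rho.
    rewrite -normrN; move: la; congr (`|_| <= _); rewrite /u; ring.
  apply: le_trans (K_smooth _ _) _; rewrite ?nu//.
    by move: (ler_wpM2l (ltW r0) rho_small) vu; lra.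
  rewrite [leRHS](_ : _ = 4 * C * (2 * rho ^+ k * rho) * rho ^+ k ^- 2); last first.
    by field; rewrite gt_eqF.
  apply: ler_wpM2r; first by rewrite invr_ge0 exprn_ge0// ltW.
  by rewrite ler_wpM2l// mulr_ge0.
rewrite mulr0 mul0r mulr0 addr0.
have ld := leaf_disagree kn jk agr dis.
have x0 : 0 < `|centre k e - leaf e'|.
  by apply: lt_le_trans (leaf_dist_ge _ _ kn); rewrite divr_gt0.
apply: le_trans (K_size _) _; first by rewrite -normr_gt0.
rewrite ler_pdivlMr// mulrAC ler_pdivrMr//.
have : C * rho ^+ k <= C * (rho * `|centre k e - leaf e'|) by rewrite ler_wpM2l.
have : 0 <= C * (rho * `|centre k e - leaf e'|) by rewrite !mulr_ge0// ltW.
lra.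
Qed.

(** The factor (2 rho)^k is the square root of the A_2 mass of a node, divided by
    that of its sigma-measure 2^-k; it turns the kernel constant K(rho^k) / 2^k into
    a number bounded by C. *)
Lemma kernel_haar_sqr k e f : (k <= n)%N ->
  ((2 * rho) ^+ k * avg (fun e' => K (centre k e - leaf e') * f e')) ^+ 2 <=
  2 * C ^+ 2 * haar_coef k f e ^+ 2 +
  128 * C ^+ 2 * (2 ^+ k * rho) ^+ 2 * avg (fun e' => f e' ^+ 2).
Proof.
move=> kn; have r0 : 0 < rho ^+ k by rewrite exprn_gt0.
pose E e' := K (centre k e - leaf e') +
  K (rho ^+ k) * (2^-1 ^+ k * cylinder R k e e' * sgn R k e').
set T := _ * avg _.
have TE : T = - (rho ^+ k * K (rho ^+ k)) * haar_coef k f e +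
     (2 * rho) ^+ k * avg (fun e' => E e' * f e').
  rewrite /T /haar_coef -2!avgZ -avgZ -avgD; apply: eq_avg => e'; rewrite /E.
  rewrite exprMn exprVn; field; by rewrite expf_neq0.
set w := avg (fun e' => E e' * f e') in TE.
have wE : w ^+ 2 <= (8 * C * rho / rho ^+ k) ^+ 2 * avg (fun e' => f e' ^+ 2).
  apply: le_trans (sqr_avg_le _) _; rewrite -avgZ; apply: avg_le => e'.
  rewrite exprMn ler_wpM2r ?sqr_ge0// -[leLHS]real_normK ?num_real//.
  have := kernel_haar e e' kn; rewrite -/(E e') => Ee.
  by rewrite lerXn2r ?nnegrE// (le_trans _ Ee).
have kap : (rho ^+ k * K (rho ^+ k)) ^+ 2 <= C ^+ 2.
  rewrite -[leLHS]real_normK ?num_real// lerXn2r ?nnegrE//.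
  rewrite normrM gtr0_norm// mulrC -ler_pdivlMr//.
  by rewrite -{2}(gtr0_norm r0) K_size// gt_eqF.
have t2 : ((2 * rho) ^+ k * w) ^+ 2 <= 64 * C ^+ 2 * (2 ^+ k * rho) ^+ 2 * avg (fun e' => f e' ^+ 2).
  rewrite exprMn.
  apply: le_trans (ler_wpM2l (sqr_ge0 _) wE) _.
  rewrite le_eqVlt; apply/orP; left; apply/eqP.
  by rewrite (exprMn k 2 rho); field; rewrite gt_eqF.
have t1 : (- (rho ^+ k * K (rho ^+ k)) * haar_coef k f e) ^+ 2 <= C ^+ 2 * haar_coef k f e ^+ 2.
  by rewrite exprMn sqrrN ler_wpM2r// sqr_ge0.
rewrite TE; set a := _ * haar_coef _ _ _ in t1 *; set b := _ * w in t2 *.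
have : (a + b) ^+ 2 <= 2 * a ^+ 2 + 2 * b ^+ 2.
  rewrite -subr_ge0 (_ : _ - _ = (a - b) ^+ 2) ?sqr_ge0//; ring.
move: t1 t2; lra.
Qed.

Hypothesis rho_tiny : n.+1%:R * (2 ^+ n.+1 * rho) <= 64^-1.

(** The Bessel inequality controls the main terms; the errors add up to
    O(N (2^N rho)^2). *)
Lemma haar_upper f :
  \sum_(k < n.+1) avg (fun e => ((2 * rho) ^+ k *
      avg (fun e' => K (centre k e - leaf e') * f e')) ^+ 2)
  <= (2 * C) ^+ 2 * avg (fun e' => f e' ^+ 2).
Proof.
set A := avg (fun e' => f e' ^+ 2).
have A0 : 0 <= A by apply: avg_ge0 => e; exact: sqr_ge0.
have := rho_tiny; set t := 2 ^+ n.+1 * rho => tiny.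
have t0 : 0 <= t by rewrite mulr_ge0// ltW.
have tn : n.+1%:R * t ^+ 2 <= 64^-1.
  have t1 : t <= 1.
    have : t <= n.+1%:R * t by rewrite ler_peMl// ler1n.
    by move: tiny; lra.
  by rewrite expr2 mulrA (le_trans _ tiny)// ler_piMr// mulr_ge0.
apply: (@le_trans _ _ (\sum_(k < n.+1) (2 * C ^+ 2 * avg (fun e => haar_coef k f e ^+ 2)
    + 128 * C ^+ 2 * t ^+ 2 * A))).
  apply: ler_sum => k _.
  have kn : (k <= n)%N by rewrite -ltnS.
  apply: le_trans (avg_le (fun e => kernel_haar_sqr e f kn)) _.
  rewrite avgD avgZ avg_cst lerD2l.
  rewrite ler_wpM2r// ler_wpM2l ?mulr_ge0 ?sqr_ge0//.
  rewrite lerXn2r ?nnegrE ?mulr_ge0//; [exact: ltW..|].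
  by rewrite /t ler_pM2r// ler_weXn2l// ?ler1n// ltnW.
rewrite big_split /= -mulr_sumr sumr_const card_ord -mulr_natr.
have := haar_bessel f; rewrite -/A => hb.
have : 2 * C ^+ 2 * \sum_(k < n.+1) avg (fun e => haar_coef k f e ^+ 2) <= 2 * C ^+ 2 * A.
  by rewrite ler_wpM2l// mulr_ge0// sqr_ge0.
have : C ^+ 2 * A * (n.+1%:R * t ^+ 2) <= C ^+ 2 * A * 64^-1.
  by rewrite ler_wpM2l// mulr_ge0// sqr_ge0.
nra.
Qed.

End Upper.

(** Pairing the two clusters below the node, the shift s > 0 brings the right one
    nearer, and the difference of the two reciprocals has a sign.  The leaves
    elsewhere contribute at most 2 rho / rho^k, negligible against 2^-k / rho^k. *)
Lemma shifted_lower k e (s : R) : (k <= n)%N ->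
  2 ^+ n.+1 * rho <= 64^-1 ->
  rho ^+ k / 8 <= s <= 3 / 8 * rho ^+ k ->
  (2 * rho) ^+ k * avg (fun e' => (centre k e + s - leaf e')^-1) <= - 32^-1.
Proof.
move=> kn tiny /andP[s1 s2]; have r0 : 0 < rho ^+ k by rewrite exprn_gt0.
have small : 2 ^+ k * rho <= 64^-1.
  apply: le_trans tiny; rewrite ler_pM2r// ler_weXn2l// ?ler1n// ltnW//.
have small1 : rho <= 64^-1.
  by apply: le_trans small; rewrite ler_peMl ?(ltW rho_gt0)// exprn_ege1// ler1n.
have rs := ler_wpM2l (ltW r0) small1.
(* With a := rho^k, the reciprocal is at most -16/15 / a on the right cluster and
   at most 16/17 / a on the left one; -A r - B takes these two values at r = 1 and
   r = -1.  Averaging over the cylinder removes A and leaves -B. *)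
pose A : R := 256 / 255; pose B : R := 16 / 255.
have pw e' : (centre k e + s - leaf e')^-1 <= (rho ^+ k)^-1 *
   (- (A * 2^-1 ^+ k) * (cylinder R k e e' * sgn R k e') +
     (- (B * 2^-1 ^+ k) * cylinder R k e e' + 2 * rho)).
  have [[agr ->]|[j jk [agr dis ->]]] := cylinderP R k e e'.
    have -> : - (A * 2^-1 ^+ k) * (2 ^+ k * sgn R k e') +
      (- (B * 2^-1 ^+ k) * 2 ^+ k + 2 * rho) = - (A * sgn R k e') - B + 2 * rho.
      by rewrite exprVn; field; rewrite expf_neq0.
    have := leaf_agree kn agr; rewrite ler_norml.
    set t := _ - _ - _ => /andP[t1 t2].
    have -> : centre k e + s - leaf e' = s - t - sgn R k e' * rho ^+ k by rewrite /t; ring.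
    apply: (@le_trans _ _ ((rho ^+ k)^-1 * (- (A * sgn R k e') - B))); last first.
      by rewrite ler_pM2l ?invr_gt0// lerDl mulr_ge0// ltW.
    case: (sgnP R k e') => ->; rewrite ?mulr1 ?mulrN1 ?opprK ?mul1r ?mulN1r ?opprK.
      have d0 : 0 < rho ^+ k - (s - t) by move: rs s1 s2 t1 t2; lra.
      have -> : (s - t - rho ^+ k)^-1 = - (rho ^+ k - (s - t))^-1.
        by rewrite -invrN; congr (_^-1); ring.
      rewrite lerNl -mulrN mulrC ler_pdivrMr// mulrC ler_pdivlMr//.
      by rewrite /A /B; move: rs s1 s2 t1 t2; lra.
    have d0 : 0 < s - t + rho ^+ k by move: rs s1 s2 t1 t2; lra.
    rewrite [leRHS]mulrC ler_pdivlMr// mulrC ler_pdivrMr//.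
    by rewrite /A /B; move: rs s1 s2 t1 t2; lra.
  rewrite mul0r !mulr0 !add0r.
  have ld := leaf_disagree kn jk agr dis.
  have h : rho ^+ k / (2 * rho) <= `|centre k e + s - leaf e'|.
    have h1 : `|centre k e - leaf e'| <= `|centre k e + s - leaf e'| + s.
      rewrite -{2}(@ger0_norm _ s); last by move: s1; nra.
      rewrite [centre k e - leaf e'](_ : _ = centre k e + s - leaf e' - s); last by ring.
      by rewrite -[in leRHS](normrN s) ler_normD.
    rewrite ler_pdivrMr ?mulr_gt0//.
    move: (ler_wpM2l (ltW rho_gt0) h1) (ler_wpM2l (ltW rho_gt0) s2) ld rs r0.
    by rewrite mulrDr; lra.
  have p0 : 0 < rho ^+ k / (2 * rho) by rewrite divr_gt0// mulr_gt0.
  have p1 := lt_le_trans p0 h.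
  apply: le_trans (ler_norm _) _; rewrite normfV.
  rewrite mulrC ler_pdivlMr// mulrC ler_pdivrMr// mulrC -ler_pdivrMr// mulr_gt0//.
apply: le_trans (ler_wpM2l _ (avg_le pw)) _.
  by rewrite exprn_ge0// mulr_ge0// ltW.
rewrite avgZ avgD avgZ avgD avgZ avg_cst avgZ avg_cylinder_sgn//.
rewrite (avg_cylinder R e (leqW kn)) mulr0 add0r mulr1 exprMn.
have -> : 2 ^+ k * rho ^+ k * ((rho ^+ k)^-1 * (- (B * 2^-1 ^+ k) + 2 * rho)) =
   - B + 2 * (2 ^+ k * rho).
  by rewrite exprVn; field; rewrite expf_neq0//= gt_eqF.
by rewrite /B; lra.
Qed.

End CantorPoints.

(** * Truncated Hilbert kernels *)

Section Kernel.
Context (R : realType) (eta : R -> R -> R -> R).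
Hypothesis adm : admissible_truncation eta.

(** The truncated kernels depend on x - y only. *)
Definition conv_kernel (d r z : R) : R := trunc_kernel eta d r z 0.

Lemma trunc_kernelE d r x y : trunc_kernel eta d r x y = conv_kernel d r (x - y).
Proof. by rewrite /conv_kernel /trunc_kernel /hilbert_kernel subr0. Qed.

Lemma conv_kernel_odd d r z : conv_kernel d r (- z) = - conv_kernel d r z.
Proof.
by rewrite /conv_kernel /trunc_kernel /hilbert_kernel !subr0 normrN mulrN invrN !mulrN.
Qed.

Definition CZ_bound (C : R) : Prop := forall d r z : R, 0 < d -> d < r ->
  z != 0 -> [/\ `|conv_kernel d r z| <= C * `|z|^-1,
    derivable (conv_kernel d r) z 1 &
    `|derive1 (conv_kernel d r) z| <= C * `|z| ^- 2].

Lemma conv_kernel_CZ : exists2 C : R, 0 <= C & CZ_bound C.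
Proof.
have [C hC] := trunc_CZ adm; exists `|C| => // d r z d0 dr z0.
have [h1 h2 _ h3] := hC d r z 0 d0 dr z0.
rewrite subr0 in h1 h3; split => //.
  by apply: le_trans h1 _; rewrite ler_wpM2r ?invr_ge0// ler_norm.
apply: le_trans (le_trans h3 _); first by rewrite lerDl.
by rewrite ler_wpM2r ?invr_ge0 ?sqr_ge0// ler_norm.
Qed.

(** Mean value theorem: the segment from u to v stays at distance |u| / 2 from 0. *)
Lemma conv_kernel_smooth C d r : 0 <= C ->
  (forall z : R, z != 0 -> derivable (conv_kernel d r) z 1 /\
    `|derive1 (conv_kernel d r) z| <= C * `|z| ^- 2) ->
  forall u v : R, 0 < `|u| -> `|v - u| <= `|u| / 2 ->
  `|conv_kernel d r v - conv_kernel d r u| <= 4 * C * `|v - u| * `|u| ^- 2.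
Proof.
move=> C0 hK u v u0 vu; set K := conv_kernel d r.
have far (z : R) : `|z - u| <= `|v - u| -> `|u| / 2 <= `|z|.
  move=> zu; have := ler_normD (u - z) z; rewrite subrK (distrC u z).
  by move: zu vu u0; lra.
have mvt (a b : R) : a <= b -> (forall z : R, z \in `[a, b] -> `|z - u| <= `|v - u|) ->
    `|K b - K a| <= 4 * C * `|u| ^- 2 * `|b - a|.
  move=> ab near.
  have nz (z : R) : z \in `[a, b] -> z != 0.
    by move=> /near/far; rewrite -normr_gt0; move: u0; lra.
  have [||c cab ->] := @MVT_segment R K (derive1 K) a b ab.
  - move=> z zab; have z0 : z != 0 by apply: nz; apply: subset_itv_oo_cc zab.
    by rewrite derive1E; apply: derivableP; case: (hK z z0).
  - by apply: derivable_within_continuous => z /nz /hK[].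
  rewrite normrM ler_wpM2r//.
  have [_ hc] := hK c (nz c cab); apply: le_trans hc _.
  rewrite [4 * C]mulrC -mulrA ler_wpM2l//.
  have cu := far c (near c cab).
  have c0 : 0 < `|c| by move: u0 cu; lra.
  rewrite ler_pdivlMr ?exprn_gt0// mulrC ler_pdivrMr ?exprn_gt0//.
  have : (`|u| / 2) ^+ 2 <= `|c| ^+ 2 by rewrite lerXn2r ?nnegrE// divr_ge0.
  by rewrite expr_div_n; lra.
rewrite mulrAC; have [uv|uv] := leP u v.
  apply: mvt => // z; rewrite in_itv /= => /andP[uz zv].
  by rewrite !ger0_norm ?subr_ge0 ?lerD2r.
rewrite distrC (distrC v); apply: mvt; first exact: ltW.
move=> z; rewrite in_itv /= => /andP[uz zv].
by rewrite distrC (distrC v) !ger0_norm ?subr_ge0 ?(ltW uv)// lerD2l lerN2.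
Qed.

(** Continuous off the origin. *)
Lemma measurable_conv_kernel d r : 0 < d -> d < r ->
  measurable_fun setT (conv_kernel d r).
Proof.
move=> d0 dr; have [C _ hK] := conv_kernel_CZ.
rewrite -(setvU [set (0 : R)]); apply/measurable_funU => //.
  exact: measurableC.
split; last exact: measurable_fun_set1.
apply: open_continuous_measurable_fun.
  by rewrite openC; exact: closed_eq.
move=> z; rewrite inE /= => /eqP z0; have [_ /derivable1_diffP dz _] := hK d r z d0 dr z0.
exact: differentiable_continuous.
Qed.

Lemma trunc_kernel_cvg x y :
  trunc_kernel eta p.1 p.2 x y @[p --> filter_prod 0^'+ +oo] -->
  hilbert_kernel x y.
Proof.
have [->|xy] := eqVneq x y.
  rewrite /trunc_kernel /hilbert_kernel subrr mulr0 invr0 mulr0.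
  under eq_cvg do rewrite mulr0.
  exact: cvg_cst.
rewrite -[X in _ --> X]mul1r; apply: cvgMr_tmp.
by apply: (trunc_cvg1 adm); rewrite normr_gt0 subr_eq0.
Qed.

Lemma near_admissible :
  \forall p \near filter_prod (0 : R)^'+ (+oo : set_system R), 0 < p.1 < p.2.
Proof.
exists ([set x | 0 < x < 1], [set x | 1 < x]) => /=.
  split; last exact: nbhs_pinfty_gt.
  near=> x; apply/andP; split; near: x.
    exact: nbhs_right_gt.
  exact: nbhs_right_lt.
move=> [a b] /= [/andP[a0 a1] b1]; rewrite a0 /=; exact: lt_trans b1.
Unshelve. all: by end_near.
Qed.

End Kernel.

(** * Finite sums of point masses and their two weight norms *)

Section Atomic.
Context (R : realType).
Local Open Scope ereal_scope.

(** The measure mu is the sum of the point masses [w i] at [p i], expressed by its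
    integrals; the points may coincide. *)
Definition atomic (mu : {measure set R -> \bar R}) (I : finType)
    (w p : I -> R) : Prop :=
  forall f : R -> \bar R, measurable_fun setT f -> (forall x, 0 <= f x) ->
  \int[mu]_x f x = \sum_i (w i)%:E * f (p i).

Lemma atomic_exists (I : finType) (w p : I -> R) :
  (forall i, (0 <= w i)%R) -> exists mu, atomic mu w p.
Proof.
move=> w0; suff [mu hmu] : exists mu : {measure set R -> \bar R},
    forall f : R -> \bar R, measurable_fun setT f -> (forall x, 0 <= f x) ->
    \int[mu]_x f x = \sum_(i <- index_enum I) (w i)%:E * f (p i).
  by exists mu.
elim: (index_enum I) => [|i s [mu IH]].
  by exists mzero => f mf f0; rewrite integral_measure_zero big_nil.
exists (measure_add (mscale (NngNum (w0 i)) (dirac (p i))) mu) => f mf f0.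
rewrite ge0_integral_measure_add// IH// ge0_integral_mscale// integral_dirac//.
by rewrite diracT mul1e big_cons.
Qed.

Section Theory.
Context (I : finType) (w p : I -> R) (mu : {measure set R -> \bar R}).
Hypotheses (w0 : forall i, (0 <= w i)%R) (mu_at : atomic mu w p).

Lemma atomic_total : mu setT = (\sum_i w i)%:E.
Proof.
have := mu_at (measurable_cst 1) (fun=> lee01); rewrite integral_cst// mul1e => ->.
by rewrite -sumEFin; apply: eq_bigr => i _; rewrite mule1.
Qed.

Lemma atomic_locally_finite : locally_finite mu.
Proof.
move=> x; exists setT; first by split => //; exact: openT.
by rewrite atomic_total ltry.
Qed.

Lemma atomic_push (Phi : R -> R) (cPhi : continuous Phi) :
  atomic (push_measure mu cPhi) w (Phi \o p).
Proof.
move=> f mf f0.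
rewrite ge0_integral_pushforward//; last exact: continuous_measurable_fun.
by rewrite preimage_setT mu_at//=; apply: measurableT_comp => //; exact: continuous_measurable_fun.
Qed.

Lemma Rintegral_atomic (f : R -> R) : measurable_fun setT f ->
  (\int[mu]_x f x = \sum_i w i * f (p i))%R.
Proof.
move=> mf; have mEf : measurable_fun setT (EFin \o f) by exact/measurable_EFinP.
rewrite /Rintegral integralE mu_at; last 2 first.
- exact: measurable_funepos.
- by move=> x; exact: funepos_ge0.
rewrite mu_at; last 2 first.
- exact: measurable_funeneg.
- by move=> x; exact: funeneg_ge0.
rewrite (eq_bigr (fun i => (w i * f^\+%R (p i))%:E)); last first.
  by move=> i _; rewrite EFinM funerpos.
rewrite [X in _ - X](eq_bigr (fun i => (w i * f^\-%R (p i))%:E)); last first.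
  by move=> i _; rewrite EFinM funerneg.
rewrite !sumEFin -EFinB /= -sumrB; apply: eq_bigr => i _.
by rewrite -mulrBr -[in RHS](funrposBneg f).
Qed.

Lemma Lnorm2_atomic (f : R -> R) : measurable_fun setT f ->
  'N[mu]_2%:E[EFin \o f] = (Num.sqrt (\sum_i w i * f (p i) ^+ 2))%:E.
Proof.
move=> mf; rewrite unlock.
rewrite (_ : (fun x => _) = (fun x => (f x ^+ 2)%:E)); last first.
  apply/funext => x; rewrite abse_EFin poweR_EFin powR_mulrn// real_normK ?num_real//.
rewrite mu_at; last 2 first.
- by apply/measurable_EFinP; exact: measurable_funX.
- by move=> x; rewrite lee_fin sqr_ge0.
rewrite sumEFin poweR_EFin powR12_sqrt// sumr_ge0// => i _.
by rewrite mulr_ge0 ?sqr_ge0.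
Qed.

End Theory.
End Atomic.

Section AtomicNorm.
Context (R : realType) (eta : R -> R -> R -> R).
Hypothesis adm : admissible_truncation eta.
Context (I J : finType) (u a : I -> R) (w b : J -> R).
Context (sigma omega : {measure set R -> \bar R}).
Hypotheses (u0 : forall i, 0 <= u i) (w0 : forall j, 0 <= w j).
Hypotheses (sigma_at : atomic sigma u a) (omega_at : atomic omega w b).

Lemma trunc_hilbert_atomic d r f : 0 < d -> d < r -> measurable_fun setT f ->
  trunc_hilbert eta d r sigma f =
  fun x => \sum_i u i * (trunc_kernel eta d r x (a i) * f (a i)).
Proof.
move=> d0 dr mf; apply/funext => x; rewrite /trunc_hilbert.
rewrite (Rintegral_atomic sigma_at)//; apply: measurable_funM => //.
rewrite (_ : trunc_kernel _ _ _ _ = conv_kernel eta d r \o (fun y => x - y)); last first.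
  by apply/funext => y; rewrite trunc_kernelE.
apply: measurableT_comp; first exact: measurable_conv_kernel.
exact: measurable_funB.
Qed.

Lemma measurable_trunc_hilbert_atomic d r f : 0 < d -> d < r ->
  measurable_fun setT f -> measurable_fun setT (trunc_hilbert eta d r sigma f).
Proof.
move=> d0 dr mf; rewrite trunc_hilbert_atomic//.
apply: measurable_sum => i; apply: measurable_funM => //; apply: measurable_funM => //.
rewrite (_ : (fun x => _) = conv_kernel eta d r \o (fun y => y - a i)); last first.
  by apply/funext => y; rewrite trunc_kernelE.
apply: measurableT_comp; first exact: measurable_conv_kernel.
exact: measurable_funB.
Qed.

Lemma hilbert_norm_atomic_le (B : R) : 0 <= B ->
  (forall d r (f : R -> R), 0 < d -> d < r ->
    \sum_j w j * (\sum_i u i * (conv_kernel eta d r (b j - a i) * f (a i))) ^+ 2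
    <= B ^+ 2 * \sum_i u i * f (a i) ^+ 2) ->
  (hilbert_norm eta sigma omega <= B%:E)%E.
Proof.
move=> B0 hB; apply: ereal_inf_lbound; exists B => //; split => // f d r fL d0 dr.
have mf : measurable_fun setT f by move: (sub_Lfun_mfun fL); rewrite inE.
rewrite (Lnorm2_atomic w0 omega_at); last exact: measurable_trunc_hilbert_atomic.
rewrite (Lnorm2_atomic u0 sigma_at)// -EFinM lee_fin.
rewrite trunc_hilbert_atomic// -{1}(ger0_norm B0) -sqrtr_sqr.
rewrite -sqrtrM ?sqr_ge0// ler_wsqrtr//.
apply: le_trans (hB d r f d0 dr); apply: ler_sum => j _.
by under eq_bigr do rewrite trunc_kernelE.
Qed.

(** Testing on the constant function 1 and letting the truncations tend to the
    Hilbert kernel.  The infimum defining the norm need not be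
    attained, whence B + 1 in place of B. *)
Lemma hilbert_norm_atomic_ge (B : R) : 0 <= B ->
  (hilbert_norm eta sigma omega <= B%:E)%E ->
  \sum_j w j * (\sum_i u i * hilbert_kernel (b j) (a i)) ^+ 2 <=
  (B + 1) ^+ 2 * \sum_i u i.
Proof.
move=> B0 hB.
have /ereal_inf_lt[_ [N [N0 hN] <-] NB] : (hilbert_norm eta sigma omega < (B + 1)%:E)%E.
  by apply: le_lt_trans hB _; rewrite lte_fin ltrDl.
rewrite lte_fin in NB.
pose S p := \sum_j w j * (\sum_i u i * trunc_kernel eta p.1 p.2 (b j) (a i)) ^+ 2.
suff SB : \forall p \near filter_prod (0 : R)^'+ (+oo : set_system R),
    S p <= (B + 1) ^+ 2 * \sum_i u i.
  apply: (cvgr_to_le _ SB).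
  apply: cvg_big => [|j _]; first exact: add_continuous.
  apply: cvgMl_tmp; rewrite /= expr2.
  under eq_cvg do rewrite expr2.
  have h : \sum_i u i * trunc_kernel eta p.1 p.2 (b j) (a i)
      @[p --> filter_prod 0^'+ +oo] --> \sum_i u i * hilbert_kernel (b j) (a i).
    apply: cvg_big => [|i _]; first exact: add_continuous.
    by apply: cvgMl_tmp; exact: trunc_kernel_cvg.
  exact: cvgM.
apply: filterS (near_admissible R) => -[d r] /= /andP[d0 dr].
have u_ge0 : 0 <= \sum_i u i by exact: sumr_ge0.
have one : cst 1 \in Lfun sigma 2%:E.
  apply/andP; split; first by rewrite inE; exact: measurable_cst.
  by rewrite inE/= /finite_norm (Lnorm2_atomic u0 sigma_at)// ltry.
have := hN (cst 1) d r one d0 dr.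
rewrite (Lnorm2_atomic w0 omega_at); last exact: measurable_trunc_hilbert_atomic.
rewrite (Lnorm2_atomic u0 sigma_at)// -EFinM lee_fin trunc_hilbert_atomic//.
have -> : \sum_j w j * (\sum_i u i * (trunc_kernel eta d r (b j) (a i) * cst 1 (a i))) ^+ 2
    = S (d, r).
  apply: eq_bigr => j _; congr (_ * _ ^+ 2).
  by apply: eq_bigr => i _; rewrite /cst mulr1.
have -> : \sum_i u i * cst 1 (a i) ^+ 2 = \sum_i u i.
  by apply: eq_bigr => i _; rewrite /cst expr1n mulr1.
move=> h.
have S0 : 0 <= S (d, r) by apply: sumr_ge0 => j _; rewrite mulr_ge0 ?sqr_ge0.
rewrite -[leLHS]sqr_sqrtr// -[\sum_i _]sqr_sqrtr// -exprMn.
rewrite lerXn2r ?nnegrE ?mulr_ge0 ?sqrtr_ge0 ?addr_ge0//.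
by apply: le_trans h _; rewrite ler_wpM2r ?sqrtr_ge0// ltW.
Qed.

End AtomicNorm.

(** * BiLipschitz perturbations of the identity *)

Section Homeo.
Context (R : realType).

Lemma lip_seminorm_le (f : R -> R) (L : R) :
  (forall x y, `|f x - f y| <= L * `|x - y|) -> (lip_seminorm f <= L%:E)%E.
Proof.
move=> fL; apply: ge_ereal_sup => _ [[x y] /= xy <-].
by rewrite lee_fin ler_pdivrMr ?normr_gt0 ?subr_eq0.
Qed.

Lemma lip_seminorm_ge0 (f : R -> R) : (0 <= lip_seminorm f)%E.
Proof.
apply: le_trans (ereal_sup_ubound _); last first.
  by exists (0 : R, 1 : R) => //=; rewrite eq_sym oner_eq0.
by rewrite lee_fin /= divr_ge0.
Qed.

Context (g : R -> R).
Hypothesis g_lip : forall x y, `|g x - g y| <= 4^-1 * `|x - y|.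

Let Phi x := x + g x.

Let Phi_le x y : `|Phi x - Phi y| <= 5 / 4 * `|x - y|.
Proof.
rewrite /Phi (_ : _ - _ = (x - y) + (g x - g y)); last by ring.
apply: le_trans (ler_normD _ _) _; have := g_lip x y; lra.
Qed.

Let Phi_ge x y : 3 / 4 * `|x - y| <= `|Phi x - Phi y|.
Proof.
have := ler_normB (Phi x - Phi y) (g x - g y).
rewrite /Phi (_ : _ - _ - _ = x - y); last by ring.
by have := g_lip x y; lra.
Qed.

Lemma continuous_perturbation : continuous Phi.
Proof.
move=> x; apply/cvgrPdist_lt => e e0; near=> y.
apply: le_lt_trans (Phi_le _ _) _.
suff : `|x - y| < e / 2 by lra.
by near: y; apply: (@cvgr_dist_lt _ _ _ _ _ id); rewrite ?divr_gt0.
Unshelve. all: by end_near.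
Qed.

(** Intermediate value theorem on [y - 2|g y|, y + 2|g y|]: there x + g x moves with
    slope at least 3/4. *)
Lemma perturbation_onto y : exists x, Phi x = y.
Proof.
have [gy t0] : - `|g y| <= g y <= `|g y| /\ 0 <= `|g y| by rewrite -ler_norml.
set t := `|g y| in gy t0; move/andP: gy => [gy1 gy2].
have h (s : R) : 0 <= s -> `|Phi (y + s) - (y + s) - g y| <= 4^-1 * s /\
   `|Phi (y - s) - (y - s) - g y| <= 4^-1 * s.
  move=> s0; split.
    have := g_lip (y + s) y; rewrite (_ : y + s - y = s); last by ring.
    rewrite (ger0_norm s0) => gs.
    by rewrite /Phi [X in `|X|](_ : _ = g (y + s) - g y); last by ring.
  have := g_lip (y - s) y; rewrite (_ : y - s - y = - s); last by ring.
  rewrite normrN (ger0_norm s0) => gs.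
    by rewrite /Phi [X in `|X|](_ : _ = g (y - s) - g y); last by ring.
have [|h1 h2] := h (2 * t); first by rewrite mulr_ge0.
move: h1 h2; rewrite !ler_norml => /andP[a1 a2] /andP[b1 b2].
have [|||x _ fx] := @IVT R Phi (y - 2 * t) (y + 2 * t) y.
- by lra.
- exact/continuous_subspaceT/continuous_perturbation.
- by rewrite ge_min le_max; apply/andP; split; apply/orP; [left|right]; lra.
by exists x.
Qed.

Lemma bilip_perturbation : exists Psi : R -> R,
  [/\ cancel Phi Psi, cancel Psi Phi & (bilip_norm Phi Psi <= 3%:E)%E].
Proof.
pose Psi y := xget 0 [set x | Phi x = y].
have PsiK : cancel Psi Phi.
  by move=> y; rewrite /Psi; case: xgetP => //= h; have [x /h] := perturbation_onto y.
exists Psi; split => //.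
  move=> x; apply/eqP; rewrite -subr_eq0 -normr_eq0.
  have := Phi_ge (Psi (Phi x)) x; rewrite PsiK subrr normr0 => h.
  by rewrite eq_le normr_ge0 andbT; move: h; lra.
rewrite (_ : 3%:E = ((5 / 4)%:E + (7 / 4)%:E)%E); last first.
  by rewrite -EFinD; congr EFin; field.
apply: leeD; first exact: lip_seminorm_le.
apply: lip_seminorm_le => x y; have := Phi_ge (Psi x) (Psi y).
by rewrite !PsiK; have := normr_ge0 (x - y); lra.
Qed.

End Homeo.

(** The distance to a finite set is attained. *)
Lemma finite_distance (R : realType) (T : finType) (t0 : T) (x : T -> R) :
  exists2 D : R -> R, (forall y t, D y <= `|y - x t|) &
    (forall y, exists t, D y = `|y - x t|).
Proof.
exists (fun y => `|y - x [arg min_(t < t0) `|y - x t|]%O|) => [y t|y].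
  by case: arg_minP => // s _ /(_ t isT).
by eexists.
Qed.

(** * The unstable pairs of measures *)

Lemma hilbert_norm_ge0 (R : realType) (eta : R -> R -> R -> R)
    (sigma omega : {measure set R -> \bar R}) : (0 <= hilbert_norm eta sigma omega)%E.
Proof. by apply: le_ereal_inf_tmp => _ [N [N0 _] <-]; rewrite lee_fin. Qed.

Section UnstablePair.
Context (R : realType) (eta : R -> R -> R -> R).
Hypothesis adm : admissible_truncation eta.
Context (n : nat).

(* Small enough for haar_upper and shifted_lower with n.+1 generations. *)
Let rho : R := (64 * n.+1%:R * 2 ^+ n.+1)^-1.

Let rho_gt0 : 0 < rho.
Proof. by rewrite invr_gt0 !mulr_gt0// ltr0n. Qed.

Let rho_tiny : n.+1%:R * (2 ^+ n.+1 * rho) <= 64^-1.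
Proof.
rewrite /rho le_eqVlt; apply/orP; left; apply/eqP; field.
by rewrite expf_neq0//= nat1r pnatr_eq0.
Qed.

Let rho_tiny1 : 2 ^+ n.+1 * rho <= 64^-1.
Proof.
apply: le_trans rho_tiny; rewrite ler_peMl ?ler1n//.
by rewrite mulr_ge0// ltW.
Qed.

Let rho_small : rho <= 4^-1.
Proof.
have : rho <= 64^-1.
  apply: le_trans rho_tiny1; rewrite ler_peMl ?(ltW rho_gt0)//.
  by rewrite exprn_ege1// ler1n.
by lra.
Qed.

Let leafw (e : branch n) : R := 2^-1 ^+ n.+1.
(* A node of generation k is listed once for each of the 2^(n.+1-k) branches
   through it, so that its total mass is rho^(2k) 2^k. *)
Let centrew (j : 'I_n.+1 * branch n) : R := 2^-1 ^+ n.+1 * ((2 * rho) ^+ j.1) ^+ 2.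
Let centrep (j : 'I_n.+1 * branch n) : R := centre rho j.1 j.2.

Let leafw_ge0 e : 0 <= leafw e.
Proof. by rewrite exprn_ge0// invr_ge0. Qed.

Let centrew_ge0 j : 0 <= centrew j.
Proof. by rewrite mulr_ge0 ?sqr_ge0// exprn_ge0// invr_ge0. Qed.

Let sum_leafw F : \sum_e leafw e * F e = avg F.
Proof. by rewrite /avg mulr_sumr. Qed.

Let sum_centrew (F : 'I_n.+1 * branch n -> R) :
  \sum_j centrew j * F j ^+ 2 =
  \sum_(k < n.+1) avg (fun e => ((2 * rho) ^+ k * F (k, e)) ^+ 2).
Proof.
rewrite (eq_bigr (fun j => centrew (j.1, j.2) * F (j.1, j.2) ^+ 2)); last by case.
rewrite -(pair_bigA _ (fun k e => centrew (k, e) * F (k, e) ^+ 2)) /=.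
apply: eq_bigr => k _; rewrite /avg mulr_sumr; apply: eq_bigr => e _.
by rewrite /centrew /=; ring.
Qed.

(** The biLipschitz norm of Phi and the norm of the original pair are bounded
    independently of n, the norm of the pushed forward pair is not. *)
Lemma unstable_pair (C : R) : 0 <= C ->
  CZ_bound eta C ->
  exists (sigma omega : {measure set R -> \bar R}) (Phi Psi : R -> R)
    (cPhi : continuous Phi),
  [/\ locally_finite sigma /\ locally_finite omega,
      cancel Phi Psi /\ cancel Psi Phi,
      (bilip_norm Phi Psi <= 3%:E)%E,
      (hilbert_norm eta sigma omega <= (2 * C)%:E)%E &
      forall B : R, 0 <= B ->
        (hilbert_norm eta (push_measure sigma cPhi) (push_measure omega cPhi)
          <= B%:E)%E ->
        n.+1%:R / (32 * pi) ^+ 2 <= (B + 1) ^+ 2].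
Proof.
move=> C0 hK.
have [sigma hs] := atomic_exists (leaf rho (n:=n)) leafw_ge0.
have [omega ho] := atomic_exists centrep centrew_ge0.
have [D D_le D_at] := finite_distance [ffun=> false] (leaf rho (n:=n)).
have D_ge0 y : 0 <= D y by have [t ->] := D_at y.
have D_leaf (e : branch n) : D (leaf rho e) = 0.
  by apply/eqP; rewrite eq_le D_ge0 andbT (le_trans (D_le _ e))// subrr normr0.
have D1 x y : D x - D y <= `|x - y|.
  have [t Dt] := D_at y; have := D_le x t.
  have : `|x - leaf rho t| <= `|x - y| + `|y - leaf rho t|.
    by rewrite -{1}(subrK y x) -addrA ler_normD.
  by rewrite Dt; lra.
have g_lip x y : `|D x / 4 - D y / 4| <= 4^-1 * `|x - y|.
  rewrite -mulrBl normrM (@ger0_norm _ (4^-1))// mulrC ler_pM2l//.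
  by rewrite ler_norml lerNl opprB D1 distrC D1.
have [Psi [K1 K2 bl]] := bilip_perturbation g_lip.
exists sigma, omega, _, Psi, (continuous_perturbation g_lip); split => //.
- split; [exact: atomic_locally_finite hs|exact: atomic_locally_finite ho].
- apply: (hilbert_norm_atomic_le adm leafw_ge0 centrew_ge0 hs ho); first exact: mulr_ge0.
  move=> d r f d0 dr; rewrite sum_leafw.
  rewrite (sum_centrew (fun j => \sum_i leafw i * (conv_kernel eta d r
     (centrep j - leaf rho i) * f (leaf rho i)))).
  under eq_bigr do under eq_avg do rewrite sum_leafw.
  apply: haar_upper => //.
  + exact: conv_kernel_odd.
  + by move=> z z0; have [] := hK d r z d0 dr z0.
  + apply: conv_kernel_smooth => // z z0; by have [] := hK d r z d0 dr z0.
- move=> B B0 hB.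
  have := hilbert_norm_atomic_ge adm leafw_ge0 centrew_ge0
    (atomic_push hs _) (atomic_push ho _) B0 hB.
  have -> : \sum_i leafw i = 1.
    rewrite -(avg_cst n 1) -sum_leafw; apply: eq_bigr => e _; by rewrite mulr1.
  rewrite mulr1; apply: le_trans.
  rewrite sum_centrew.
  apply: (@le_trans _ _ (\sum_(k < n.+1) (32 * pi) ^- 2)).
    by rewrite sumr_const card_ord mulr_natl.
  apply: ler_sum => k _; rewrite -[leLHS](avg_cst n); apply: avg_le => e.
  rewrite sum_leafw /centrep /=.
  set c := centre rho k e; set s := D c / 4.
  have kn : (k <= n)%N by rewrite -ltnS.
  have s_int : rho ^+ k / 8 <= s <= 3 / 8 * rho ^+ k.
    have [t Dt] := D_at c; have h1 := leaf_dist_ge rho_gt0 rho_small e t kn.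
    have h2 := le_trans (D_le c e) (leaf_dist_le rho_gt0 rho_small e kn).
    rewrite -/c -Dt in h1; rewrite /s; apply/andP; split; lra.
  have low := shifted_lower rho_gt0 rho_small e kn rho_tiny1 s_int.
  have -> : avg (fun e' : branch n => hilbert_kernel (c + s) (leaf rho e' + D (leaf rho e') / 4))
      = pi^-1 * avg (fun e' : branch n => (c + s - leaf rho e')^-1).
    rewrite -avgZ; apply: eq_avg => e'.
    by rewrite D_leaf mul0r addr0 /hilbert_kernel div1r invfM.
  rewrite mulrCA [leRHS]exprMn.
  have -> : (32 * pi : R) ^- 2 = pi^-1 ^+ 2 * 32^-1 ^+ 2.
    by rewrite exprMn invfM mulrC !exprVn.
  rewrite ler_wpM2l ?sqr_ge0// -[leRHS]sqrrN lerXn2r ?nnegrE//; lra.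
Qed.

End UnstablePair.

Theorem mainTheorem5 (R : realType) (eta : R -> R -> R -> R)
    (adm_eta : admissible_truncation eta) :
  ~ exists G : R * R -> R,
    [/\ forall p : R * R, 0 <= p.1 -> 0 <= p.2 -> 0 <= G p,
        forall A : set (R * R),
          A `<=` [set p | 0 <= p.1 /\ 0 <= p.2] ->
          bounded_set A -> bounded_set (G @` A)
      & forall (sigma omega : {measure set R -> \bar R}) (Phi Psi : R -> R)
          (cPhi : continuous Phi),
          locally_finite sigma -> locally_finite omega ->
          (hilbert_norm eta sigma omega < +oo)%E ->
          cancel Phi Psi -> cancel Psi Phi ->
          (bilip_norm Phi Psi < +oo)%E ->
          (hilbert_norm eta (push_measure sigma cPhi) (push_measure omega cPhi)
             <= (G (fine (bilip_norm Phi Psi),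
                    fine (hilbert_norm eta sigma omega)))%:E)%E].
Proof.
move=> [G [_ G_bnd G_ctrl]].
have [C C0 hC] := conv_kernel_CZ adm_eta.
pose A := [set p : R * R | 0 <= p.1 <= 3 /\ 0 <= p.2 <= 2 * C].
have A_bnd : bounded_set A.
  exists (3 + 2 * C); split; first exact: num_real.
  move=> M CM p [/andP[a1 a2] /andP[b1 b2]].
  change (Num.max `|p.1| `|p.2| <= M); rewrite ge_max !ger0_norm//; apply/andP; split; lra.
have /pinfty_ex_gt0[M M0 hM] : bounded_set (G @` A).
  by apply: G_bnd A_bnd => p [/andP[? _] /andP[? _]].
pose n := Num.bound ((M + 1) ^+ 2 * (32 * pi) ^+ 2 : R).
have [sigma [omega [Phi [Psi [cPhi [[s_lf o_lf] [K1 K2] bl hn low]]]]]] :=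
  unstable_pair adm_eta n C0 hC.
have bl_fin : bilip_norm Phi Psi \is a fin_num.
  rewrite ge0_fin_numE; first by apply: le_lt_trans bl _; rewrite ltry.
  by rewrite adde_ge0// lip_seminorm_ge0.
have hn_fin : hilbert_norm eta sigma omega \is a fin_num.
  rewrite ge0_fin_numE ?hilbert_norm_ge0//.
  by apply: le_lt_trans hn _; rewrite ltry.
have := G_ctrl sigma omega Phi Psi cPhi s_lf o_lf _ K1 K2.
rewrite -!ge0_fin_numE ?hilbert_norm_ge0 ?adde_ge0 ?lip_seminorm_ge0//.
move=> /(_ hn_fin bl_fin); set p := (_, _) => hG.
have Ap : A p.
  rewrite /A /p /= !fine_ge0 ?hilbert_norm_ge0 ?adde_ge0 ?lip_seminorm_ge0//.
  by split; rewrite -lee_fin fineK.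
have GM : G p <= M by apply: le_trans (ler_norm _) (hM _ _); exists p.
have := low M (ltW M0) (le_trans hG _); rewrite lee_fin => /(_ GM).
have pi32 : 0 < (32 * pi : R) ^+ 2 by rewrite exprn_gt0// mulr_gt0// pi_gt0.
rewrite ler_pdivrMr// => h.
have := archi_boundP (mulr_ge0 (sqr_ge0 (M + 1)) (ltW pi32)).
by rewrite ltNge (le_trans _ h)// ler_nat.
Qed.
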